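(* Let $V$ be a Hausdorff topological vector space over $\mathbb{R}$ whose topology is weak, and let $A\subseteq V\setminus\{0\}$. The following are equivalent: (i) $A$ is topologically linearly independent; (ii) $A$ is topologically independent; (iii) $A$ is absolutely Cauchy summable and minimal; (iv) the map $\mathbb{Z}^{(A)}\to\langle A\rangle$, $(z_a)_{a\in A}\mapsto\sum_{a\in A}z_a a$, is an isomorphism of topological groups; (v) the map $\mathbb{R}^{(A)}\to\langle A\rangle_{\mathbb{R}}$, $(r_a)_{a\in A}\mapsto\sum_{a\in A}r_a a$, is an isomorphism of topological vector spaces.
   Context: The topology of a topological vector space $X$ is weak if it coincides with the coarsest topology making all continuous linear functionals on $X$ continuous. $\langle A\rangle$ is the additive subgroup and $\langle A\rangle_{\mathbb{R}}$ the linear span generated by $A$, both with the subspace topology. $\mathbb{Z}^{(A)}$ (resp. $\mathbb{R}^{(A)}$) is the set of finitely supported functions $A\to\mathbb{Z}$ (resp. $A\to\mathbb{R}$) with the topology induced from the product topology of $\mathbb{Z}^A$ ($\mathbb{Z}$ discrete) resp. $\mathbb{R}^A$. A subset $A\subseteq V\setminus\{0\}$ is topologically linearly independent if for every neighborhood $W$ of $0$ there is a neighborhood $U$ of $0$ such that for every finite $F\subseteq A$ and reals $\{r_a: a\in F\}$, $\sum_{a\in F}r_a a\in U$ implies $r_a a\in W$ for all $a\in F$; it is topologically independent if the same holds with integers $z_a$ in place of reals. $A$ is minimal if $a\notin\overline{\langle A\setminus\{a\}\rangle_{\mathbb{R}}}$ for every $a\in A$. $A$ is absolutely Cauchy summable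 if for every neighborhood $V_0$ of $0$ there is a finite $F\subseteq A$ with $\langle A\setminus F\rangle\subseteq V_0$. *)

(* Defs.v *)
From HB Require Import structures.
From mathcomp Require Import all_boot all_order all_algebra.
From mathcomp Require Import all_classical all_reals all_analysis.
Set Implicit Arguments. Unset Strict Implicit. Unset Printing Implicit Defensive.
Import Order.TTheory GRing.Theory Num.Theory.
Local Open Scope classical_set_scope.
Local Open Scope ring_scope.

Section Defs.
Variables (R : realType) (V : topologicalLmodType R).

Definition lin_functional (f : V -> R) : Prop :=
  forall (a : R) (x y : V), f (a *: x + y) = a * f x + f y.

(** The topology of V is weak: it coincides with the coarsest topology making
    all continuous linear functionals continuous.  Every continuous linear
    functional is continuous for the original topology, so the weak topology
    is always coarser; "coincides" thus means that every neighbourhood of a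
    point x contains a basic weak neighbourhood
    { y | |f_i y - f_i x| < e for i < n } with f_0..f_(n-1) continuous linear
    functionals and e > 0. *)
Definition weak_topology_tvs : Prop :=
  forall (x : V) (U : set V), nbhs x U ->
    exists (n : nat) (f : 'I_n -> V -> R),
      (forall i, lin_functional (f i) /\ continuous (f i : V -> R^o)) /\
      exists2 e : R, 0 < e &
        [set y | forall i, `|f i y - f i x| < e] `<=` U.

Definition fin_sub (A : set V) (F : seq V) : Prop :=
  uniq F /\ (forall a, a \in F -> A a).

Definition zspan (A : set V) : set V :=
  [set v | exists (F : seq V) (z : V -> int),
      fin_sub A F /\ v = \sum_(a <- F) a *~ z a].

Definition rspan (A : set V) : set V :=
  [set v | exists (F : seq V) (r : V -> R),
      fin_sub A F /\ v = \sum_(a <- F) r a *: a].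

Definition top_lin_indep (A : set V) : Prop :=
  forall W : set V, nbhs (0 : V) W ->
  exists2 U : set V, nbhs (0 : V) U &
    forall (F : seq V) (r : V -> R), fin_sub A F ->
      U (\sum_(a <- F) r a *: a) -> forall a, a \in F -> W (r a *: a).

Definition top_indep (A : set V) : Prop :=
  forall W : set V, nbhs (0 : V) W ->
  exists2 U : set V, nbhs (0 : V) U &
    forall (F : seq V) (z : V -> int), fin_sub A F ->
      U (\sum_(a <- F) a *~ z a) -> forall a, a \in F -> W (a *~ z a).

Definition minimal_set (A : set V) : Prop :=
  forall a, A a -> ~ closure (rspan (A `\ a)) a.

Definition abs_cauchy_summable (A : set V) : Prop :=
  forall V0 : set V, nbhs (0 : V) V0 ->
    exists F : seq V, (forall a, a \in F -> A a) /\
      zspan (A `\` [set x | x \in F]) `<=` V0.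

Definition ZA (A : set V) := {ptws set_type A -> discrete_topology int}.
Definition ZfinA (A : set V) : set (ZA A) :=
  [set z | finite_set [set i | (z i : int) != 0]].
Definition phiZ (A : set V) (z : ZA A) : V :=
  \sum_(i \in [set: set_type A]) (val i *~ (z i : int)).

Definition RA (A : set V) := {ptws set_type A -> R^o}.
Definition RfinA (A : set V) : set (RA A) :=
  [set r | finite_set [set i | (r i : R) != 0]].
Definition phiR (A : set V) (r : RA A) : V :=
  \sum_(i \in [set: set_type A]) ((r i : R) *: val i).

Definition phiZ_top_group_iso (A : set V) : Prop :=
  [/\ (forall z1 z2 : ZA A, ZfinA z1 -> ZfinA z2 ->
         phiZ (fun i => (z1 i : int) + z2 i : discrete_topology int)
         = phiZ z1 + phiZ z2),
      (forall z : ZA A, ZfinA z -> zspan A (phiZ z)) &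
      exists psi : V -> ZA A,
        [/\ forall v, zspan A v -> ZfinA (psi v),
            forall z, ZfinA z -> psi (phiZ z) = z,
            forall v, zspan A v -> phiZ (psi v) = v,
            {within @ZfinA A, continuous (@phiZ A)} &
            {within zspan A, continuous psi}]].

Definition phiR_tvs_iso (A : set V) : Prop :=
  [/\ (forall (c : R) (r1 r2 : RA A), RfinA r1 -> RfinA r2 ->
         phiR (fun i => c * r1 i + r2 i : R) = c *: phiR r1 + phiR r2),
      (forall r : RA A, RfinA r -> rspan A (phiR r)) &
      exists psi : V -> RA A,
        [/\ forall v, rspan A v -> RfinA (psi v),
            forall r, RfinA r -> psi (phiR r) = r,
            forall v, rspan A v -> phiR (psi v) = v,
            {within @RfinA A, continuous (@phiR A)} &
            {within rspan A, continuous psi}]].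

End Defs.

(* Main.v *)
(** Everything is compared with one algebraic condition, [biorthogonal A]: each
    continuous linear form vanishes at all but finitely many points of [A], and
    each [a] in [A] has a continuous linear form [h] with [h a = 1] vanishing on
    the rest of [A].  Such forms are the coordinates inverting the sum maps, and
    since a weak neighbourhood of [0] sees only finitely many forms, hence only
    finitely many elements of [A], the condition gives (i), (iii), (iv), (v).
    Conversely, let [A] be topologically independent, let [g] be a form and let
    [f_1, ..., f_n] define a neighbourhood adapted to [|g| < 1].  A real relation
    [sum_b r_b f_i b = 0] with [r_a g a <> 0] would, by simultaneous Diophantine
    approximation of the [r_b / r_a] and multiplication by a large integer, give
    an integer combination that is small for every [f_i] although its [a]-term
    is not small for [g].  So the [f_i] see linear independence wherever [g] does
    not vanish: at most [n] such points exist, and elimination among the [f_i]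
    yields the coordinate forms. *)
Require Import Defs.
From HB Require Import structures.
From mathcomp Require Import all_boot all_order all_algebra.
From mathcomp Require Import all_classical all_reals all_analysis.
From mathcomp Require Import finmap ring lra.
Set Implicit Arguments. Unset Strict Implicit. Unset Printing Implicit Defensive.
Import Order.TTheory GRing.Theory Num.Theory.
Local Open Scope classical_set_scope.
Local Open Scope ring_scope.

(** * Diophantine approximation and finite-dimensional linear algebra *)

(** Pigeonhole on the fractional parts of the multiples [k * r a], the unit cube being cut into
    boxes of side [1/N < d]: [q] is the difference of two multipliers whose points share a box. *)
Lemma simultaneous_dirichlet (R : realType) (T : choiceType) (F : seq T)
    (r : T -> R) (d : R) : 0 < d ->
  exists2 q : nat, (0 < q)%N &
    exists p : T -> int, forall a, a \in F -> `|q%:R * r a - (p a)%:~R| < d.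
Proof.
move=> d0.
have [n Nd] : exists n, n.+1%:R^-1 < d.
  by exists (Num.truncn d^-1); rewrite invf_plt ?posrE ?ltr0n// truncnS_gt.
set N := n.+1 in Nd.
have N0 : 0 < N%:R :> R by rewrite ltr0n.
pose fl (k : nat) a : int := Num.floor (k%:R * r a).
pose fr (k : nat) a : R := k%:R * r a - (fl k a)%:~R.
have fr0 k a : 0 <= fr k a by rewrite subr_ge0 floor_le.
have fr1 k a : fr k a < 1.
  by rewrite ltrBlDl; move: (floorD1_gt (k%:R * r a)); rewrite rmorphD.
pose box k a : 'I_N := inord (Num.truncn (N%:R * fr k a)).
have boxE k a : box k a = Num.truncn (N%:R * fr k a) :> nat.
  rewrite inordK// -/N -(ltr_nat R).
  apply: (@le_lt_trans _ _ (N%:R * fr k a)); last by rewrite gtr_pMr.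
  by rewrite truncn_le mulr_ge0 ?fr0 ?ltW.
(* The [.+1] gives one more multiplier than there are boxes. *)
pose bx (k : 'I_#|{ffun seq_sub F -> 'I_N}|.+1) : {ffun seq_sub F -> 'I_N} :=
  [ffun a => box k (val a)].
have /injectivePn[k [l neq_kl bxkl]] : ~~ injectiveb bx.
  by apply/injectiveP => /leq_card; rewrite card_ord ltnn.
wlog lt_kl : k l neq_kl bxkl / (k < l)%N.
  move=> wl; case: (ltngtP k l) => [|lt_lk|/val_inj/eqP]; first exact: wl.
  - by apply: (wl l k) => //; rewrite eq_sym.
  - by rewrite (negPf neq_kl).
exists (l - k)%N; first by rewrite subn_gt0.
exists (fun a => fl l a - fl k a) => a aF.
have -> : (l - k)%:R * r a - (fl l a - fl k a)%:~R = fr l a - fr k a.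
  rewrite /fr intrB natrB; last exact: ltnW.
  by ring.
apply: (@lt_trans _ _ N%:R^-1) Nd.
have trE : Num.truncn (N%:R * fr k a) = Num.truncn (N%:R * fr l a).
  have /ffunP/(_ (SeqSub aF)) := bxkl.
  by rewrite !ffunE /= => /(congr1 val) /=; rewrite !boxE.
have Nfr k' : 0 <= N%:R * fr k' a by rewrite mulr_ge0 ?fr0 ?ltW.
rewrite -(ltr_pM2l N0) divff ?gt_eqF// -[X in X * `|_|]gtr0_norm// -normrM.
rewrite mulrBr.
have /andP[ka kb] := truncn_itv (Nfr k); have /andP[la lb] := truncn_itv (Nfr l).
rewrite trE in ka kb.
move: (N%:R * fr l a) (N%:R * fr k a) ka kb la lb => x y ka kb la lb.
by rewrite -!natr1 in kb lb; rewrite ltr_norml; apply/andP; split; lra.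
Qed.

(** Fredholm alternative: the row [v] of values at [a] lies in the row space of [M], or some column
    of the cokernel of [M] does not kill [v]. *)
Lemma comb_or_separating_form (R : fieldType) (T : choiceType) n
    (f : 'I_n -> T -> R) (F : seq T) (a : T) : uniq F ->
  (exists r : T -> R, forall i, f i a = \sum_(b <- F) r b * f i b) \/
  (exists2 c : 'I_n -> R, \sum_i c i * f i a = 1 &
     forall b, b \in F -> \sum_i c i * f i b = 0).
Proof.
move=> uF.
pose M := \matrix_(j < size F, i < n) f i (nth a F j).
pose v := \row_(i < n) f i a.
have [/submxP[D vE]|vM] := boolP (v <= M)%MS; [left|right].
  exists (fun b => oapp (D 0) 0 (insub (index b F))) => i.
  have := congr1 (fun w : 'rV_n => w 0 i) vE; rewrite !mxE => ->.
  rewrite (big_nth a) big_mkord; apply: eq_bigr => j _.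
  by rewrite index_uniq// valK mxE.
move: vM; rewrite submxE => /rV0Pn[j vj].
(* This column kills every row of [M]; dividing by its value on [v] makes that value [1]. *)
exists (fun i => cokermx M i j / (v *m cokermx M) 0 j).
  under eq_bigr do rewrite mulrAC.
  rewrite -mulr_suml.
  rewrite [X in X / _](_ : _ = (v *m cokermx M) 0 j) ?divff//.
  by rewrite mxE; apply: eq_bigr => i _; rewrite mulrC [in RHS]mxE.
move=> b bF.
under eq_bigr do rewrite mulrAC.
rewrite -mulr_suml; pose k := Ordinal (etrans (index_mem b F) bF).
rewrite [X in X / _](_ : _ = (M *m cokermx M) k j).
  by rewrite mulmx_coker mxE mul0r.
by rewrite mxE; apply: eq_bigr => i _; rewrite mulrC [in RHS]mxE nth_index.
Qed.

(** The matrix of values has more rows than columns, so its left kernel is nonzero. *)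
Lemma linear_dependency (R : fieldType) (T : choiceType) n
    (f : 'I_n -> T -> R) (F : seq T) : uniq F -> (n < size F)%N ->
  exists r : T -> R, (exists2 a, a \in F & r a != 0) /\
    forall i, \sum_(b <- F) r b * f i b = 0.
Proof.
case: F => [//|x0 F]; set G := x0 :: F => uG nG.
pose M := \matrix_(j < size G, i < n) f i (nth x0 G j).
have : kermx M != 0.
  rewrite kermx_eq0 /row_free neq_ltn (leq_ltn_trans (rank_leq_col M))//.
case/matrix0Pn => k [j kj].
pose r b := oapp (kermx M k) 0 (insub (index b G)).
have rE (i : 'I_(size G)) : r (nth x0 G i) = kermx M k i.
  by rewrite /r index_uniq// valK.
exists r; split; first by exists (nth x0 G j); rewrite ?mem_nth// rE.
move=> i; transitivity ((kermx M *m M) k i); last by rewrite mulmx_ker mxE.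
rewrite mxE (big_nth x0) big_mkord; apply: eq_bigr => l _.
by rewrite rE; congr (_ * _); rewrite mxE.
Qed.

(** * Continuous linear forms and weak neighbourhoods *)

Section Independence.
Context (R : realType) (V : topologicalLmodType R).
Implicit Types (A : set V) (F : seq V) (f g h : V -> R).

Definition dual_form f : Prop := lin_functional f /\ continuous (f : V -> R^o).

Lemma lin_functional0 f : lin_functional f -> f 0 = 0.
Proof. by move=> /(_ (-1) 0 0); rewrite scaler0 addr0 mulN1r addNr. Qed.

Lemma lin_functionalZ f : lin_functional f -> forall c x, f (c *: x) = c * f x.
Proof. by move=> lf c x; rewrite -[c *: x]addr0 lf lin_functional0// addr0. Qed.

Lemma lin_functional_int f : lin_functional f ->
  forall x (z : int), f (x *~ z) = z%:~R * f x.
Proof. by move=> lf x z; rewrite -scaler_int lin_functionalZ. Qed.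

Lemma lin_functional_sum f (I : Type) (s : seq I) (v : I -> V) :
  lin_functional f -> f (\sum_(i <- s) v i) = \sum_(i <- s) f (v i).
Proof.
move=> lf; elim/big_rec2: _ => [|i x y _ <-]; first exact: lin_functional0.
by rewrite -[v i]scale1r lf mul1r scale1r.
Qed.

Lemma lin_functional_comb f (F : seq V) (r : V -> R) : lin_functional f ->
  f (\sum_(a <- F) r a *: a) = \sum_(a <- F) r a * f a.
Proof.
move=> lf; rewrite lin_functional_sum//.
by apply: eq_bigr => a _; rewrite lin_functionalZ.
Qed.

Lemma lin_functional_zcomb f (F : seq V) (z : V -> int) : lin_functional f ->
  f (\sum_(a <- F) a *~ z a) = \sum_(a <- F) (z a)%:~R * f a.
Proof.
move=> lf; rewrite lin_functional_sum//.
by apply: eq_bigr => a _; rewrite lin_functional_int.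
Qed.

Lemma dual_form_comb n (f : 'I_n -> V -> R) (c : 'I_n -> R) :
  (forall i, dual_form (f i)) -> dual_form (fun v => \sum_i c i * f i v).
Proof.
move=> df; split.
  move=> a x y; rewrite mulr_sumr -big_split; apply: eq_bigr => i _ /=.
  by rewrite (df i).1 mulrDr mulrCA.
apply: (@continuous_big R^o _ +%R 0 xpredT (@add_continuous R^o)) => i _ x.
apply: (@cvgM R V _ _ (fun=> c i) (f i)); first exact: (@cvg_cst R^o).
exact: (df i).2.
Qed.

Lemma nbhs_dual_forms n (f : 'I_n -> V -> R) (e : R) (x : V) :
  (forall i, dual_form (f i)) -> 0 < e ->
  nbhs x [set y | forall i, `|f i y - f i x| < e].
Proof.
move=> df e0; apply: filter_forall => i.
have /cvgrPdist_lt/(_ e e0) := (df i).2 x.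
by apply: filterS => y; rewrite distrC.
Qed.

Lemma nbhs0_dual_forms n (f : 'I_n -> V -> R) (e : R) :
  (forall i, dual_form (f i)) -> 0 < e ->
  nbhs (0 : V) [set y | forall i, `|f i y| < e].
Proof.
move=> df e0; apply: filterS (nbhs_dual_forms 0 df e0) => y + i => /(_ i).
by rewrite (lin_functional0 (df i).1) subr0.
Qed.

Lemma nbhs0_dual_form f (e : R) : dual_form f -> 0 < e ->
  nbhs (0 : V) [set y | `|f y| < e].
Proof.
move=> df e0; have := @nbhs0_dual_forms 1 (fun=> f) e (fun=> df) e0.
by apply: filterS => y /(_ ord0).
Qed.

Lemma weak_nbhs0 (U : set V) : weak_topology_tvs V -> nbhs (0 : V) U ->
  exists n (f : 'I_n -> V -> R), (forall i, dual_form (f i)) /\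
    exists2 e : R, 0 < e & [set y | forall i, `|f i y| < e] `<=` U.
Proof.
move=> wV /wV[n [f [df [e e0 fU]]]]; exists n, f; split => //.
exists e => // y fy; apply: fU => i.
by rewrite (lin_functional0 (df i).1) subr0; exact: fy.
Qed.

(** If every continuous form vanished at [a], every weak neighbourhood of [0] would contain [a],
    against separation. *)
Lemma weak_separates (a : V) : hausdorff_space V -> weak_topology_tvs V ->
  a != 0 -> exists2 g, dual_form g & g a != 0.
Proof.
move=> hV wV a0.
have [g dg ga] : exists2 g, dual_form g & g a <> 0; last by exists g => //; exact/eqP.
apply: contrapT => nog.
suff a0E : a = 0 by rewrite a0E eqxx in a0.
apply: hV => P Q Pa Q0.
have [n [f [df [e e0 fQ]]]] := weak_nbhs0 wV Q0.
exists a; split; first exact: nbhs_singleton Pa.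
apply: fQ => i; suff -> : f i a = 0 by rewrite normr0.
by apply: contrapT => fa; apply: nog; exists (f i).
Qed.

(** * Biorthogonality against independence, summability and minimality *)

Definition locally_finite_forms A : Prop := forall g, dual_form g ->
  exists2 F, fin_sub A F & forall a, A a -> a \notin F -> g a = 0.

Definition has_coordinate_forms A : Prop := forall a, A a ->
  exists h, [/\ dual_form h, h a = 1 & forall b, A b -> b != a -> h b = 0].

Definition biorthogonal A : Prop :=
  locally_finite_forms A /\ has_coordinate_forms A.

Lemma locally_finite_forms_fam A n (f : 'I_n -> V -> R) :
  locally_finite_forms A -> (forall i, dual_form (f i)) ->
  exists2 F, fin_sub A F & forall i a, A a -> a \notin F -> f i a = 0.
Proof.
move=> lA df.
have /choice[G GP] i : exists F, fin_sub A F /\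
    forall a, A a -> a \notin F -> f i a = 0.
  by have [F ? ?] := lA _ (df i); exists F.
exists (undup (flatten [seq G i | i <- enum 'I_n])).
  split; first exact: undup_uniq.
  move=> a; rewrite mem_undup => /flatten_mapP[i _ aG].
  exact: (GP i).1.2.
move=> i a Aa aG; apply: (GP i).2 => //; apply: contra aG => aG.
by rewrite mem_undup; apply/flatten_mapP; exists i; rewrite ?mem_enum.
Qed.

(* Linear algebra replaces Hahn-Banach: the forms [f] map the span of [A `\ a]
   onto a finite-dimensional subspace missing the image of [a]. *)
Lemma coordinate_form A n (f : 'I_n -> V -> R) (a : V) :
  locally_finite_forms A -> (forall i, dual_form (f i)) ->
  (forall F r, fin_sub (A `\ a) F ->
     ~ forall i, f i a = \sum_(b <- F) r b * f i b) ->
  exists h, [/\ dual_form h, h a = 1 & forall b, A b -> b != a -> h b = 0].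
Proof.
move=> lA df nof.
have [F [uF FA] F0] := locally_finite_forms_fam lA df.
pose G := rem a F.
have uG : uniq G by exact: rem_uniq.
have [[r rE]|[c c1 c0]] := comb_or_separating_form f a uG.
  exfalso; apply: (nof G r) rE; split => // b.
  by rewrite mem_rem_uniq// !inE => /andP[/eqP ba bF]; split => //; exact: FA.
exists (fun v => \sum_i c i * f i v); split => //; first exact: dual_form_comb.
move=> b Ab ba; have [bF|bF] := boolP (b \in F).
  by apply: c0; rewrite mem_rem_uniq// !inE ba.
by rewrite big1// => i _; rewrite F0// mulr0.
Qed.

(** Diophantine approximation carries a hypothesis on integer combinations over to real relations.
    The forms [f] are fixed before [F] and [r], so [n] bounds the number of points where [g] is
    nonzero. *)
Lemma top_indep_relation A g : weak_topology_tvs V -> top_indep A ->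
  dual_form g ->
  exists n (f : 'I_n -> V -> R), (forall i, dual_form (f i)) /\
    forall F r, fin_sub A F -> (forall i, \sum_(b <- F) r b * f i b = 0) ->
      forall a, a \in F -> r a * g a = 0.
Proof.
move=> wV tA dg.
have [U U0 UP] := tA _ (nbhs0_dual_form dg ltr01).
have [n [f [df [e e0 fU]]]] := weak_nbhs0 wV U0.
exists n, f; split => // F r FA fr a aF.
apply/eqP; rewrite mulf_eq0; apply/norP => -[ra ga].
have g0 : 0 < `|g a| by rewrite normr_gt0.
(* With this [m], every nonzero integer multiple of [m * g a] has absolute value above [1]. *)
pose m := (Num.truncn `|g a|^-1).+1.
have m1 : 1 < m%:R * `|g a| by rewrite -ltr_pdivrMr// div1r truncnS_gt.
pose B := \sum_(i < n) \sum_(b <- F) `|f i b|.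
have B0 : 0 <= B by apply: sumr_ge0 => i _; apply: sumr_ge0.
(* The bound [1] forces [p a = q], because the ratio at [a] is [1]; the other bound gives
   [m * d * B < e]. *)
pose d := Num.min 1 (e / (m%:R * (1 + B))).
have m0 : 0 < m%:R :> R by rewrite ltr0n.
have mB0 : 0 < m%:R * (1 + B) by rewrite mulr_gt0// ltr_pwDl.
have d0 : 0 < d by rewrite lt_min ltr01 divr_gt0.
have [q q0 [p qp]] := simultaneous_dirichlet F (fun b => r b / r a) d0.
have paq : p a = q.
  have := lt_le_trans (qp _ aF) (_ : d <= 1); rewrite ge_min lexx => /(_ isT).
  rewrite divff// mulr1 -[q%:R]/(q%:Z%:~R) -intrB -intr_norm.
  rewrite -[1]/(1%:~R) ltr_int -[X in _ < X]add0r ltzD1 normr_le0 subr_eq0.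
  by move/eqP.
have mpE b : (m%:Z * p b)%:~R = m%:R * (p b)%:~R :> R by rewrite intrM -pmulrn.
have Uv : U (\sum_(b <- F) b *~ (m%:Z * p b)).
  apply: fU => i /=; rewrite (lin_functional_zcomb _ _ (df i).1).
  (* Adding a multiple of the vanishing relation replaces the integer coefficients by approximation
     errors. *)
  have -> : \sum_(b <- F) (m%:Z * p b)%:~R * f i b =
      - m%:R * \sum_(b <- F) (q%:R * (r b / r a) - (p b)%:~R) * f i b.
    transitivity (\sum_(b <- F) ((- m%:R * q%:R / r a) * (r b * f i b)
       + (m%:Z * p b)%:~R * f i b)).
      by rewrite big_split/= -mulr_sumr fr mulr0 add0r.
    rewrite mulr_sumr; apply: eq_bigr => b _.
    by rewrite mpE; field.
  rewrite normrM normrN normr_nat.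
  set S := `|_|; have Sd : S <= d * B.
    apply: le_trans (ler_norm_sum _ _ _) _.
    apply: (@le_trans _ _ (\sum_(b <- F) d * `|f i b|)).
      rewrite big_seq [leRHS]big_seq; apply: ler_sum => b bF.
      by rewrite normrM ler_wpM2r// ltW// qp.
    rewrite -mulr_sumr ler_wpM2l ?(ltW d0)// /B (bigD1 i)//= lerDl.
    by apply: sumr_ge0 => j _; apply: sumr_ge0.
  have dm : d * (m%:R * (1 + B)) <= e.
    by rewrite -ler_pdivlMr// ge_min lexx orbT.
  have md0 : 0 < m%:R * d by rewrite mulr_gt0.
  have : m%:R * S <= m%:R * (d * B) by rewrite ler_pM2l.
  move: m0 md0 dm; generalize (m%:R : R) => M *; lra.
(* Independence gives [m * q * |g a| < 1], although [q >= 1] and [m * |g a| > 1]. *)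
have := UP F (fun b => m%:Z * p b) FA Uv a aF => /=.
rewrite (lin_functional_int dg.1) mpE paq normrM -pmulrn -natrM normr_nat.
apply/negP; rewrite -leNgt natrM mulrAC (le_trans (ltW m1))//.
by rewrite ler_peMr ?ler1n// mulr_ge0// ltW.
Qed.

Lemma top_indep_biorthogonal A : hausdorff_space V -> weak_topology_tvs V ->
  ~ A 0 -> top_indep A -> biorthogonal A.
Proof.
move=> hV wV A0 tA.
have lA : locally_finite_forms A.
  move=> g dg; have [n [f [df frel]]] := top_indep_relation wV tA dg.
  have /finite_seqP[s sE] : finite_set [set a | A a /\ g a != 0].
    (* On [n + 1] points the [n] forms satisfy a nontrivial relation, which makes [g] vanish at one
       of them. *)
    apply: contrapT => /(@infinite_set_fset _ _ n.+1)[B BA nB].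
    have [r [[a aB ra] rel]] := linear_dependency f (fset_uniq B) nB.
    have FB : fin_sub A B by split; [exact: fset_uniq|move=> b /BA[]].
    have /eqP := frel _ _ FB rel _ aB.
    by rewrite mulf_eq0 (negPf ra) (negPf (BA _ aB).2).
  exists (undup s).
    split; first exact: undup_uniq.
    move=> a; rewrite mem_undup => ain.
    by have [] : [set a | A a /\ g a != 0] a by rewrite sE.
  move=> a Aa; rewrite mem_undup => /negP anin; apply/eqP/negP => ga.
  by apply: anin; have : [set` s] a by rewrite -sE; split => //; exact/negP.
split => // a Aa.
have a0 : a != 0 by apply/eqP => aE; rewrite aE in Aa.
have [g dg ga] := weak_separates hV wV a0.
have [n [f [df frel]]] := top_indep_relation wV tA dg.
apply: (coordinate_form lA df) => F r [uF FA] rel.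
(* Coefficient [-1] at [a] turns the expression of [f i a] through [F] into a relation on
   [a :: F]. *)
pose r' b := if b == a then -1 else r b.
have aF : a \notin F by apply/negP => /FA[_]; exact.
have : r' a * g a = 0.
  apply: (frel (a :: F)); last by rewrite mem_head.
    split; first by rewrite /= aF.
    by move=> b; rewrite inE => /predU1P[->//|/FA[]].
  move=> i; rewrite big_cons /r' eqxx mulN1r rel addrC; apply/eqP.
  rewrite subr_eq0; apply/eqP; apply: eq_big_seq => b bF.
  by case: eqP => // bE; rewrite -bE bF in aF.
by rewrite /r' eqxx mulN1r => /eqP; rewrite oppr_eq0 (negPf ga).
Qed.

(** A form bounded by [1] on a subgroup vanishes there, whence local finiteness. Minimality gives a
    weak neighbourhood of [a] missing the span of the other points; its forms yield the coordinate
    at [a]. *)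
Lemma summable_minimal_biorthogonal A : weak_topology_tvs V ->
  abs_cauchy_summable A -> minimal_set A -> biorthogonal A.
Proof.
move=> wV sA mA.
have lA : locally_finite_forms A.
  move=> g dg; have [F [FA Fg]] := sA _ (nbhs0_dual_form dg ltr01).
  exists (undup F).
    by split; [exact: undup_uniq|move=> a; rewrite mem_undup => /FA].
  move=> a Aa; rewrite mem_undup => /negP aF.
  apply/eqP/negP => /negP ga; have g0 : 0 < `|g a| by rewrite normr_gt0.
  pose m := (Num.truncn `|g a|^-1).+1.
  have : `|g (a *~ m)| < 1.
    apply: Fg; exists [:: a], (fun=> m%:Z); split; last by rewrite big_seq1.
    by split => // b; rewrite inE => /eqP ->.
  rewrite (lin_functional_int dg.1) normrM -pmulrn normr_nat -ltr_pdivlMr//.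
  by rewrite div1r ltNge ltW// truncnS_gt.
split => // a Aa.
have /existsNP[U /not_implyP[Ua]] := mA _ Aa.
move=> /set0P/negP; rewrite negbK => /eqP UA0.
have [n [f [df [e e0 fU]]]] := wV _ _ Ua.
apply: (coordinate_form lA df) => F r FA rel.
suff : (rspan (A `\ a) `&` U) (\sum_(b <- F) r b *: b) by rewrite UA0.
split; first by exists F, r.
by apply: fU => i; rewrite (lin_functional_comb _ _ (df i).1) rel subrr normr0.
Qed.

(** Off a finite set, all forms defining the neighbourhood vanish, hence also on the subgroup
    generated there. *)
Lemma biorthogonal_summable A : weak_topology_tvs V -> biorthogonal A ->
  abs_cauchy_summable A.
Proof.
move=> wV [lA _] W W0; have [n [f [df [e e0 fW]]]] := weak_nbhs0 wV W0.
have [F [uF FA] F0] := locally_finite_forms_fam lA df.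
exists F; split => // v [G [z [[uG GA] ->]]].
apply: fW => i /=; rewrite (lin_functional_zcomb _ _ (df i).1).
rewrite big_seq big1 ?normr0// => a /GA[Aa /negP aF].
by rewrite F0 ?mulr0.
Qed.

Lemma coordinate_form_comb A F (r : V -> R) h (a : V) : lin_functional h ->
  h a = 1 -> (forall b, A b -> b != a -> h b = 0) -> fin_sub A F ->
  h (\sum_(b <- F) r b *: b) = if a \in F then r a else 0.
Proof.
move=> lh ha hb [uF FA]; rewrite lin_functional_comb//.
rewrite big_seq; case: ifPn => aF.
  rewrite -big_seq (big_rem a)//= ha mulr1 big_seq big1 ?addr0// => b.
  by rewrite mem_rem_uniq// !inE => /andP[ba bF]; rewrite hb ?mulr0//; exact: FA.
rewrite big1// => b bF; rewrite hb ?mulr0//; first exact: FA.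
by apply: contraNneq aF => <-.
Qed.

(** The coordinate form at [a] is [1] at [a] and [0] on the span of the rest. *)
Lemma biorthogonal_minimal A : biorthogonal A -> minimal_set A.
Proof.
move=> [_ cA] a Aa clA; have [h [dh ha hb]] := cA _ Aa.
have [v [[F [r [FA vE]]]]] :=
  clA _ (@nbhs_dual_forms 1 (fun=> h) 1 a (fun=> dh) ltr01).
move=> /(_ ord0); rewrite ha vE.
rewrite (coordinate_form_comb _ dh.1 ha hb) ?ifN ?sub0r ?normrN1 ?ltxx//.
  by apply/negP => /FA.2[_]; exact.
by split; [exact: FA.1|move=> b /FA.2[]].
Qed.

(** Only the finitely many points of [F] are seen by the forms defining [W], so it suffices that [U]
    bounds the coordinates at those points. *)
Lemma biorthogonal_top_lin_indep A : weak_topology_tvs V -> biorthogonal A ->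
  top_lin_indep A.
Proof.
move=> wV [lA cA] W W0; have [n [f [df [e e0 fW]]]] := weak_nbhs0 wV W0.
have [F [uF FA] F0] := locally_finite_forms_fam lA df.
have hP (j : 'I_(size F)) : exists h, [/\ dual_form h,
    h (tnth (in_tuple F) j) = 1 &
    forall b, A b -> b != tnth (in_tuple F) j -> h b = 0].
  by apply/cA/FA; exact: mem_tnth.
have /choice[h {}hP] := hP.
(* [B] dominates each [|f i a|] with [a] in [F]; below, [1 + B] keeps the quotient defined when
   [B = 0]. *)
pose B := \sum_(i < n) \sum_(b <- F) `|f i b|.
have B0 : 0 <= B by apply: sumr_ge0 => i _; apply: sumr_ge0.
have B1 : 0 < 1 + B by rewrite ltr_pwDl.
have d0 : 0 < e / (1 + B) by rewrite divr_gt0.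
have dh j : dual_form (h j) by have [] := hP j.
exists [set v | forall j, `|h j v| < e / (1 + B)]; first exact: nbhs0_dual_forms.
move=> G r GA /= hG a aG; apply: fW => i /=.
rewrite (lin_functionalZ (df i).1) normrM.
have [/tnthP[j aj]|aF] := boolP (a \in in_tuple F); last first.
  by rewrite F0 ?normr0 ?mulr0//; exact: GA.2.
have [_ ha hb] := hP j; rewrite -aj in ha hb.
have := hG j; rewrite (coordinate_form_comb _ (dh j).1 ha hb GA) aG.
rewrite ltr_pdivlMr// => /le_lt_trans; apply; rewrite ler_wpM2l//.
have aF : a \in F by rewrite aj; exact: mem_tnth.
rewrite (@le_trans _ _ B)// ?lerDr// /B (bigD1 i)//= (big_rem a)//= -addrA lerDl.
by rewrite addr_ge0// sumr_ge0// => *; apply: sumr_ge0.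
Qed.

End Independence.

(** * Cylinders and convergence in the pointwise topology *)

(** The sets containing a cylinder around [x] form a filter. The topology being a supremum over
    coordinates, its convergence to [x] is checked one coordinate at a time. *)
Lemma ptws_nbhs_cylinder (I : eqType) (T : topologicalType)
    (x : {ptws I -> T}) (N : set {ptws I -> T}) : nbhs x N ->
  exists (D : seq I) (B : I -> set T), (forall i, nbhs (x i) (B i)) /\
    forall y : {ptws I -> T}, (forall i, i \in D -> B i (y i)) -> N y.
Proof.
pose G : set_system {ptws I -> T} := [set N | exists (D : seq I)
  (B : I -> set T), (forall i, nbhs (x i) (B i)) /\
    forall y : {ptws I -> T}, (forall i, i \in D -> B i (y i)) -> N y].
have GF : Filter G.
  split.
  - by exists [::], (fun=> setT); split => // i; exact: filterT.
  - move=> P Q [D [B [Bx DP]]] [D2 [B2 [Bx2 DQ]]].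
    exists (D ++ D2), (fun i => B i `&` B2 i); split => [i|y yD].
      exact: filterI.
    split; [apply: DP|apply: DQ] => i iD.
      by have [] := yD i (_ : i \in D ++ D2); rewrite ?mem_cat ?iD.
    by have [] := yD i (_ : i \in D ++ D2); rewrite ?mem_cat ?iD ?orbT.
  - move=> P Q PQ [D [B [Bx DP]]]; exists D, B; split => // y /DP; exact: PQ.
suff Gx : G --> x by exact: Gx.
apply/cvg_sup => i P [_ [[B oB <-] Bx BP]].
exists [:: i], (fun j => if j == i then B else setT); split.
  move=> j; case: eqP => [->|_]; last exact: filterT.
  exact: open_nbhs_nbhs.
by move=> y /(_ i (mem_head _ _)); rewrite eqxx => Oy; exact: BP.
Qed.

Lemma cvg_ptws (I : eqType) (T : topologicalType) (S : Type)
    (F : set_system S) (f : S -> {ptws I -> T}) (x : {ptws I -> T}) : Filter F ->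
  (forall i, f s i @[s --> F] --> x i) -> f @ F --> x.
Proof.
move=> FF fx N /ptws_nbhs_cylinder[D [B [Bx DN]]].
suff : \forall s \near F, forall i, i \in D -> B i (f s i).
  by apply: filterS => s; exact: DN.
elim: D {DN} => [|j D IH]; first exact: filterE.
apply: filterS2 IH (fx j _ (Bx j)) => s sD sj i.
by rewrite inE => /predU1P[->//|]; exact: sD.
Qed.

Lemma ptws_proj_continuous (I : eqType) (T : topologicalType) (i : I) :
  continuous (fun y : {ptws I -> T} => y i).
Proof. exact: (@proj_continuous I (fun=> T)). Qed.

(** * Sums with finitely supported coefficients *)

Section CoefficientSums.
Context (R : realType) (V : topologicalLmodType R) (A : set V).
Implicit Types (F : seq V) (w : set_type A -> R).

Definition coeff_sum w : V := \sum_(i \in [set: set_type A]) w i *: val i.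

(** Moves coefficients from the subtype to [V], where the lists [F] live. *)
Definition extend0 (T : Type) (t0 : T) (w : set_type A -> T) (a : V) : T :=
  oapp w t0 (insub a).

Lemma extend0_val (T : Type) (t0 : T) (w : set_type A -> T) i :
  extend0 t0 w (val i) = w i.
Proof. by rewrite /extend0 valK. Qed.

Lemma coeff_sumE w (r : V -> R) F : fin_sub A F ->
  (forall i, val i \notin F -> w i = 0) ->
  (forall i, val i \in F -> r (val i) = w i) ->
  coeff_sum w = \sum_(a <- F) r a *: a.
Proof.
move=> [uF FA] w0 rw.
pose s : seq (set_type A) := pmap insub F.
have sF : map val s = F.
  rewrite (pmap_filter (insubK _)); apply/all_filterP/allP => a /FA Aa.
  by rewrite isSome_insub; exact: mem_set.
rewrite /coeff_sum (fsbigE s)//; first 1 last.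
- by rewrite -(map_inj_uniq val_inj) sF.
- move=> i _ is_; rewrite w0 ?scale0r// -sF.
  by rewrite (mem_map val_inj).
rewrite (eq_bigl xpredT) => [|i]; last exact/mem_set.
rewrite -[in RHS]sF big_map; apply: eq_big_seq => i is_.
by rewrite rw// -sF map_f.
Qed.

Lemma finite_support w : finite_set [set i | w i != 0] ->
  exists2 F, fin_sub A F & forall i, val i \notin F -> w i = 0.
Proof.
move=> /finite_seqP[s sE]; exists (map val (undup s)).
  split; first by rewrite (map_inj_uniq val_inj) undup_uniq.
  by move=> a /mapP[i _ ->]; exact: set_valP.
move=> i; rewrite (mem_map val_inj) mem_undup => si.
apply/eqP; apply: contraNT si => wi.
suff : [set` s] i by [].
by rewrite -sE.
Qed.

Lemma coeff_sum_extend w F : fin_sub A F ->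
  (forall i, val i \notin F -> w i = 0) ->
  coeff_sum w = \sum_(a <- F) extend0 0 w a *: a.
Proof. by move=> FA w0; apply: coeff_sumE => // i _; rewrite extend0_val. Qed.

Lemma coeff_sum_linear (k : R) w1 w2 :
  finite_set [set i | w1 i != 0] -> finite_set [set i | w2 i != 0] ->
  coeff_sum (fun i => k * w1 i + w2 i) = k *: coeff_sum w1 + coeff_sum w2.
Proof.
move=> /finite_support[F1 [u1 FA1] w1F] /finite_support[F2 [u2 FA2] w2F].
pose F := undup (F1 ++ F2).
have FA : fin_sub A F.
  split; first exact: undup_uniq.
  by move=> a; rewrite mem_undup mem_cat => /orP[/FA1|/FA2].
have w10 i : val i \notin F -> w1 i = 0.
  by rewrite mem_undup mem_cat negb_or => /andP[/w1F].
have w20 i : val i \notin F -> w2 i = 0.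
  by rewrite mem_undup mem_cat negb_or => /andP[_ /w2F].
rewrite (@coeff_sumE _ (fun a => k * extend0 0 w1 a + extend0 0 w2 a) F)//.
- rewrite !(@coeff_sum_extend _ F)// scaler_sumr -big_split.
  by apply: eq_bigr => a _; rewrite scalerDl scalerA.
- by move=> i iF; rewrite w10// w20// mulr0 addr0.
- by move=> i _; rewrite !extend0_val.
Qed.

(** [F0] depends on [f] alone, so [f] of the sum is a fixed finite combination of coordinates; this
    is what makes the sum map continuous. *)
Lemma dual_form_coeff_sum f F0 w : lin_functional f ->
  fin_sub A F0 -> (forall a, A a -> a \notin F0 -> f a = 0) ->
  finite_set [set i | w i != 0] ->
  f (coeff_sum w) = \sum_(a <- F0) extend0 0 w a * f a.
Proof.
move=> lf [u0 FA0] f0 /finite_support[F [u FA] wF].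
pose G := undup (F ++ F0).
have GA : fin_sub A G.
  split; first exact: undup_uniq.
  by move=> a; rewrite mem_undup mem_cat => /orP[/FA|/FA0].
rewrite (@coeff_sum_extend _ G)//; last first.
  by move=> i; rewrite mem_undup mem_cat negb_or => /andP[/wF].
rewrite lin_functional_comb// (bigID (mem F0))/= [X in _ + X]big1_seq ?addr0.
  rewrite -big_filter; apply: perm_big; apply: uniq_perm => //.
    by rewrite filter_uniq// undup_uniq.
  move=> a; rewrite mem_filter mem_undup mem_cat.
  by case: (a \in F0); rewrite ?orbT.
by move=> a /andP[aF0 /GA.2 Aa]; rewrite f0 ?mulr0.
Qed.

Lemma coordinate_form_coeff_sum h i w : lin_functional h ->
  h (val i) = 1 -> (forall b, A b -> b != val i -> h b = 0) ->
  finite_set [set i | w i != 0] -> h (coeff_sum w) = w i.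
Proof.
move=> lh h1 h0 wfin.
rewrite (@dual_form_coeff_sum _ [:: val i])//.
- by rewrite big_seq1 h1 mulr1 extend0_val.
- by split => // b; rewrite inE => /eqP ->; exact: set_valP.
- by move=> b Ab; rewrite inE; exact: h0.
Qed.

(* [c : T -> R] is the identity of [R] or the inclusion of the discrete integers,
   so that (iv) and (v) are treated together. *)
Section CoefficientType.
Context (T : topologicalType) (c : T -> R) (t0 : T) (c0 : c t0 = 0).

Local Notation X := {ptws set_type A -> T}.

Definition coeff_map (z : X) : V := coeff_sum (fun i => c (z i)).

Local Notation phi := coeff_map.

Definition fsupp : set X := [set z | finite_set [set i | c (z i) != 0]].

Definition cspan : set V := [set v | exists F (r : V -> T),
  fin_sub A F /\ v = \sum_(a <- F) c (r a) *: a].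

Definition restrict F (r : V -> T) : X :=
  fun i => if val i \in F then r (val i) else t0.

Lemma restrict_fsupp F r : fin_sub A F -> fsupp (restrict F r).
Proof.
move=> [uF FA]; apply: (@sub_finite_set _ _ [set` pmap insub F]).
  move=> i /=; rewrite /restrict mem_pmap_sub; case: ifP => //.
  by rewrite c0 eqxx.
exact: finite_seq.
Qed.

Lemma phi_restrict F r : fin_sub A F ->
  phi (restrict F r) = \sum_(a <- F) c (r a) *: a.
Proof.
move=> FA; apply: coeff_sumE => // i iF; rewrite /restrict.
  by rewrite (negPf iF).
by rewrite iF.
Qed.

Lemma phi_cspan (z : X) : fsupp z -> cspan (phi z).
Proof.
move=> /finite_support[F FA zF]; exists F, (extend0 t0 z); split => //.
by apply: coeff_sumE => // i _; rewrite extend0_val.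
Qed.

(** Continuity of [phi] at [0] gives a cylinder sent into [W], and continuity of [psi] at [0] gives
    [U]. Zeroing all coordinates but one stays in a cylinder around zero, so each single term lies
    in [W]. *)
Lemma phi_inverse_indep (S : set X) (P : set V) (psi : V -> X) :
  (forall z, S z <-> fsupp z) -> (forall v, P v <-> cspan v) ->
  (forall z, S z -> psi (phi z) = z) ->
  {within S, continuous phi} -> {within P, continuous psi} ->
  forall W, nbhs (0 : V) W -> exists2 U, nbhs (0 : V) U &
    forall F (r : V -> T), fin_sub A F -> U (\sum_(a <- F) c (r a) *: a) ->
      forall a, a \in F -> W (c (r a) *: a).
Proof.
move=> SE PE psiK /subspace_continuousP cphi /subspace_continuousP cpsi W W0.
have nilA : fin_sub A [::] by split.
pose z0 : X := restrict [::] (fun=> t0).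
have Sz0 : S z0 by apply/SE/restrict_fsupp.
have phi0 : phi z0 = 0 by rewrite phi_restrict// big_nil.
have [D [B [Bz0 DW]]] : exists (D : seq (set_type A)) (B : set_type A -> set T),
    (forall i, nbhs (z0 i) (B i)) /\
    forall y : X, (forall i, i \in D -> B i (y i)) -> S y -> W (phi y).
  apply: (@ptws_nbhs_cylinder _ _ z0 [set y | S y -> W (phi y)]).
  by apply: (cphi z0 Sz0 W) => //; rewrite -phi0 in W0.
have P0 : P 0 by apply/PE; exists [::], (fun=> t0); rewrite big_nil.
have psi0 : psi 0 = z0 by rewrite -phi0 psiK.
exists [set v | P v -> forall i, i \in D -> B i (psi v i)].
  suff : nbhs (psi 0) [set y : X | forall i, i \in D -> B i (y i)].
    exact: cpsi.
  rewrite psi0; elim: D {DW} => [|j D IH]; first exact: filterE.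
  apply: filterS2 IH (ptws_proj_continuous (Bz0 j)) => y yD yj i.
  by rewrite inE => /predU1P[->//|]; exact: yD.
move=> F r FA /= UF a aF.
have PF : P (\sum_(a <- F) c (r a) *: a) by apply/PE; exists F, r.
have := UF PF; rewrite -phi_restrict// psiK; last exact/SE/restrict_fsupp.
move=> FB; have aA : fin_sub A [:: a].
  by split => // b; rewrite inE => /eqP ->; exact: FA.2.
rewrite -[X in W X](big_seq1 +%R a (fun a => c (r a) *: a)).
rewrite -phi_restrict//; apply: DW; last exact/SE/restrict_fsupp.
move=> i iD; rewrite {1}/restrict inE; case: eqP => [ia|_].
  by have := FB i iD; rewrite /restrict ia aF.
by have := nbhs_singleton (Bz0 i); rewrite /z0 /restrict.
Qed.

(** The hypotheses on [c] make it a topological embedding with left inverse [d]; the inverse of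
    [phi] applies [d] to the coordinate forms. *)
Lemma biorthogonal_phi_iso (d : R -> T) (S : set X) (P : set V) :
  weak_topology_tvs V -> biorthogonal A ->
  continuous (c : T -> R^o) -> cancel c d ->
  (forall t B, nbhs t B ->
     exists2 e : R, 0 < e & forall t', `|c t' - c t| < e -> B t') ->
  (forall z, S z <-> fsupp z) -> (forall v, P v <-> cspan v) ->
  exists psi : V -> X,
    [/\ forall v, P v -> S (psi v),
        forall z, S z -> psi (phi z) = z,
        forall v, P v -> phi (psi v) = v,
        {within S, continuous phi} &
        {within P, continuous psi}].
Proof.
move=> wV [lA cA] cc cK cemb SE PE.
have /choice[H HP] (i : set_type A) : exists h, [/\ dual_form h, h (val i) = 1 &
    forall b, A b -> b != val i -> h b = 0] by exact/cA/set_valP.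
pose psi v : X := fun i => d (H i v).
have HE F r i : fin_sub A F ->
    H i (\sum_(a <- F) c (r a) *: a) = c (restrict F r i).
  move=> FA; have [dh h1 h0] := HP i.
  rewrite (coordinate_form_comb _ dh.1 h1 h0 FA) /restrict.
  by case: ifP => // _; rewrite c0.
have psiE F r : fin_sub A F ->
    psi (\sum_(a <- F) c (r a) *: a) = restrict F r.
  by move=> FA; apply/funext => i; rewrite /psi HE// cK.
exists psi; split.
- by move=> v /PE[F [r [FA ->]]]; apply/SE; rewrite psiE//; exact: restrict_fsupp.
- move=> z /SE fz; apply/funext => i; rewrite /psi.
  have [dh h1 h0] := HP i.
  by rewrite (coordinate_form_coeff_sum dh.1 h1 h0 fz) cK.
- by move=> v /PE[F [r [FA ->]]]; rewrite psiE// phi_restrict.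
- apply/subspace_continuousP => z /SE fz W /wV[n [f [df [e e0 fW]]]].
  have [F FA F0] := locally_finite_forms_fam lA df.
  have fphi i (y : X) : fsupp y ->
      f i (phi y) = \sum_(a <- F) c (extend0 t0 y a) * f i a.
    move=> fy; rewrite (dual_form_coeff_sum (df i).1 FA (F0 i) fy).
    apply: eq_bigr => a _; congr (_ * _); rewrite /extend0.
    by case: (insub a) => [j|] /=; rewrite ?c0.
  (* Each [f i] after [phi] reads only the coordinates in the finite list [F]. *)
  have cf i : continuous
      ((fun y : X => \sum_(a <- F) c (extend0 t0 y a) * f i a) : X -> R^o).
    apply: (@continuous_big R^o _ +%R 0 xpredT (@add_continuous R^o)) => a _ y.
    apply: (@cvgM R X (nbhs y) (nbhs_filter y) (fun y => c (extend0 t0 y a))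
      (fun=> f i a)); last exact: (@cvg_cst R^o _ X _ (nbhs_filter y)).
    rewrite /extend0; case: insub => [j|] /=; last first.
      exact: (@cvg_cst R^o _ X _ (nbhs_filter y)).
    apply: (@continuous_comp X T R^o (fun y => y j) c); last exact: cc.
    exact: ptws_proj_continuous.
  have : \forall y \near z, forall i, `|\sum_(a <- F) c (extend0 t0 z a) * f i a -
      \sum_(a <- F) c (extend0 t0 y a) * f i a| < e.
    by apply: (@filter_forall _ _ _ _ (nbhs_filter z)) => i; have /cvgrPdist_lt/(_ e e0) := cf i z.
  apply: filterS => y fy /SE Sy; apply: fW => i /=.
  by rewrite !fphi// distrC.
- apply/subspace_continuousP => v Pv.
  suff psi_cvg i : psi u i @[u --> within P (nbhs v)] --> psi v i.
    exact: cvg_ptws psi_cvg.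
  (* On the span the coordinate forms take values in the image of [c], so their continuity passes to
     [psi] through [cemb], without continuity of [d]. *)
  move: Pv => /PE[F [r [FA ->]]] B; rewrite psiE// => /cemb[e e0 eB].
  have [dh h1 h0] := HP i.
  have /cvgrPdist_lt/(_ e e0) := dh.2 (\sum_(a <- F) c (r a) *: a).
  apply: filterS => u Hu /PE[G [s [GA uE]]].
  apply: eB; rewrite /psi distrC -HE//.
  by move: Hu; rewrite uE (HE G)// cK.
Qed.

End CoefficientType.
End CoefficientSums.

(** * The integer and the real sum maps *)

Section Isomorphisms.
Context (R : realType) (V : topologicalLmodType R) (A : set V).

Lemma phiZE (z : ZA A) : phiZ z = coeff_sum (fun i => (z i : int)%:~R).
Proof. by apply: eq_fsbigr => i _; rewrite scaler_int. Qed.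

Lemma ZfinAE (z : ZA A) :
  ZfinA z <-> fsupp (intr : discrete_topology int -> R) z.
Proof.
rewrite /ZfinA /fsupp /= (_ : [set i | _] = [set i | (z i : int)%:~R != 0 :> R])//.
by apply/funext => i /=; rewrite intr_eq0.
Qed.

Lemma zspanE (v : V) :
  zspan A v <-> cspan A (intr : discrete_topology int -> R) v.
Proof.
by split=> -[F [r [FA ->]]]; exists F, r; split => //;
  apply: eq_bigr => a _; rewrite scaler_int.
Qed.

Lemma phiZ_top_group_iso_indep : phiZ_top_group_iso A -> top_indep A.
Proof.
move=> [_ _ [psi [_ psiK _ cphi cpsi]]] W W0.
have phiE : @phiZ R V A = coeff_map (intr : discrete_topology int -> R).
  by apply/funext => z; rewrite phiZE.
rewrite phiE in psiK cphi.
have [U U0 UW] := phi_inverse_indep (c := intr : discrete_topology int -> R)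
  (t0 := 0 : int) (erefl : 0%:~R = 0 :> R) ZfinAE zspanE psiK cphi cpsi W0.
exists U => // F z FA; under eq_bigr do rewrite -scaler_int.
by move=> Uz a aF; rewrite -scaler_int; exact: UW FA Uz a aF.
Qed.

Lemma biorthogonal_phiZ_iso : weak_topology_tvs V -> biorthogonal A ->
  phiZ_top_group_iso A.
Proof.
move=> wV bA.
have phiE : @phiZ R V A = coeff_map (intr : discrete_topology int -> R).
  by apply/funext => z; rewrite phiZE.
split.
- move=> z1 z2 /ZfinAE z1f /ZfinAE z2f; rewrite !phiZE -[X in X + _]scale1r.
  rewrite -coeff_sum_linear//; congr coeff_sum; apply/funext => i.
  by rewrite mul1r intrD.
- move=> z /ZfinAE zf; rewrite phiZE; apply/zspanE.
  exact: (phi_cspan (c := intr : discrete_topology int -> R) (0 : int)).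
- rewrite phiE.
  apply: (biorthogonal_phi_iso (c := intr : discrete_topology int -> R)
    (t0 := 0 : int) _ (d := @Num.floor R)) => //.
  + move=> t N Nt; apply: (filterS _ (discrete_set1 t)) => _ ->.
    exact: nbhs_singleton Nt.
  + by move=> t; rewrite intrKfloor.
  (* Distinct integers are at distance at least [1]. *)
  + move=> t B Bt; exists 1 => // t'.
    rewrite -intrB -intr_norm -[1]/(1%:~R) ltr_int -[X in _ < X]add0r ltzD1.
    rewrite normr_le0 subr_eq0 => /eqP ->; exact: nbhs_singleton Bt.
  + exact: ZfinAE.
  + exact: zspanE.
Qed.

Lemma phiR_tvs_iso_indep : phiR_tvs_iso A -> top_lin_indep A.
Proof.
move=> [_ _ [psi [_ psiK _ cphi cpsi]]] W W0.
exact: (phi_inverse_indep (c := id : R^o -> R) (t0 := 0) erefl (S := @RfinA R V A)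
  (P := rspan A) (fun=> iff_refl _) (fun=> iff_refl _) psiK cphi cpsi W0).
Qed.

Lemma biorthogonal_phiR_iso : weak_topology_tvs V -> biorthogonal A ->
  phiR_tvs_iso A.
Proof.
move=> wV bA; split.
- by move=> k r1 r2 r1f r2f; exact: coeff_sum_linear.
- move=> r rf; exact: (phi_cspan (c := id : R^o -> R) 0).
- apply: (biorthogonal_phi_iso (c := id : R^o -> R) (t0 := 0) _ (d := id)) => //.
  + by move=> t.
  + move=> t B /(@nbhs_ballP _ R^o)[e e0 eB]; exists e => // t' tt'; apply: eB.
    by rewrite /ball/= distrC.
Qed.

End Isomorphisms.

Theorem theorem3p8 (R : realType) (V : topologicalLmodType R) (A : set V) :
  hausdorff_space V -> weak_topology_tvs V -> ~ A 0 ->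
  [/\ (top_lin_indep A <-> top_indep A),
      (top_indep A <-> abs_cauchy_summable A /\ minimal_set A),
      (abs_cauchy_summable A /\ minimal_set A <-> phiZ_top_group_iso A) &
      (phiZ_top_group_iso A <-> phiR_tvs_iso A)].
Proof.
move=> hV wV A0.
have indepB := top_indep_biorthogonal hV wV A0.
have linB : top_lin_indep A -> biorthogonal A.
  (* Integer coefficients are a special case of real ones. *)
  move=> tA; apply: indepB => W /tA[U U0 UW]; exists U => // F z FA.
  under eq_bigr do rewrite -scaler_int.
  by move=> /(UW F (fun a => (z a)%:~R) FA) FW a /FW; rewrite scaler_int.
have Blin := biorthogonal_top_lin_indep wV.
have Zindep := @phiZ_top_group_iso_indep R V A.
have BZ := biorthogonal_phiZ_iso wV.
have Rlin := @phiR_tvs_iso_indep R V A.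
have BR := biorthogonal_phiR_iso wV.
have sumB : abs_cauchy_summable A /\ minimal_set A <-> biorthogonal A.
  split=> [[]|bA]; first exact: summable_minimal_biorthogonal.
  by split; [exact: biorthogonal_summable|exact: biorthogonal_minimal].
have Bindep : biorthogonal A -> top_indep A by move=> /BZ/Zindep.
split; split.
- by move=> /linB/Bindep.
- by move=> /indepB/Blin.
- by move=> /indepB/sumB.
- by move=> /sumB/Bindep.
- by move=> /sumB/BZ.
- by move=> /Zindep/indepB/sumB.
- by move=> /Zindep/indepB/BR.
- by move=> /Rlin/linB/BZ.
Qed.
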